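(* Let $X_n$, $n\in\omega$, be pointed topological $T_1$-spaces such that each $X_n$ has the strong Pytkeev$^*$ property at its distinguished point $*_{X_n}$. Then the box-bouquet $\bigvee_{n\in\omega}X_n$ and the small box-product $\boxdot_{n\in\omega}X_n$ both have the strong Pytkeev$^*$ property at their distinguished points $( *_{X_n})_{n\in\omega}$.
   Context: A sequence $(x_n)_{n\in\omega}$ in a topological space $Z$ accumulates at $z\in Z$ if each neighborhood of $z$ contains $x_n$ for infinitely many indices $n\in\omega$. A family $\mathcal N$ of subsets of $Z$ is a Pytkeev$^*$ network at $z\in Z$ if for each neighborhood $O_z$ of $z$ and each sequence $(x_n)_{n\in\omega}\in Z^\omega$ accumulating at $z$ there is $N\in\mathcal N$ such that $z\in N\subset O_z$ and $N$ contains $x_n$ for infinitely many $n$. The space $Z$ has the strong Pytkeev$^*$ property at $z$ if $Z$ has a countable (i.e. at most countable) Pytkeev$^*$ network at $z$. A pointed space is a topological space $X$ with a distinguished point $*_X$. The box-product $\square_{\alpha\in A}X_\alpha$ is the Cartesian product $\prod_{\alpha\in A}X_\alpha$ with the box topology, generated by the products $\prod_{\alpha\in A}U_\alpha$ of open sets $U_\alpha\subset X_\alpha$. For pointed spaces $X_\alpha$, the small box-product is the subspace $$\boxdot_{\alpha\in A}X_\alpha=\big\{(x_\alpha)_{\alpha\in A}\in\square_{\alpha\in A}X_\alpha:\{\alpha\in A:x_\alpha\neq *_{X_\alpha}\}\text{ is finite}\big\}$$ of $\square_{\alpha\in A}X_\alpha$, and the box-bouquet $\bigvee_{\alpha\in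 A}X_\alpha$ is the set $$\big\{(x_\alpha)_{\alpha\in A}:\big|\{\alpha\in A:x_\alpha\neq *_{X_\alpha}\}\big|\le 1\big\}$$ with the box topology inherited from $\square_{\alpha\in A}X_\alpha$. Both have distinguished point $( *_{X_\alpha})_{\alpha\in A}$. *)

(* Defs.v *)
From HB Require Import structures.
From mathcomp Require Import all_boot.
From mathcomp Require Import all_classical topology.

Set Implicit Arguments.
Unset Strict Implicit.
Unset Printing Implicit Defensive.

Local Open Scope classical_set_scope.
Local Open Scope card_scope.

Section pytkeev.
Context {Z : topologicalType}.

Definition accumulating (x : nat -> Z) (z : Z) : Prop :=
  forall U : set Z, nbhs z U -> infinite_set [set n | U (x n)].

Definition pytkeev_star_network (NN : set (set Z)) (z : Z) : Prop :=
  forall (O : set Z) (x : nat -> Z), nbhs z O -> accumulating x z ->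
    exists N : set Z,
      [/\ NN N, N z, N `<=` O & infinite_set [set n | N (x n)]].

(* [countable] allows finite families. *)
Definition strong_pytkeev_star (z : Z) : Prop :=
  exists2 NN : set (set Z), countable NN & pytkeev_star_network NN z.

End pytkeev.

Arguments strong_pytkeev_star Z z : clear implicits.

(* An alias of the dependent product: the bare type [forall a, X a] already
   carries the Tychonoff product topology in the library. *)
Definition box_product (A : Type) (X : A -> Type) : Type := forall a, X a.

Section box_topology.
Context {A : Type} {X : A -> topologicalType}.

Definition box (U : forall a, set (X a)) : set (box_product X) :=
  [set x | forall a, U a (x a)].

Definition open_family : set (forall a, set (X a)) :=
  [set U | forall a, open (U a)].

Lemma box_cover : \bigcup_(U in open_family) box U = setT.
Proof.
by apply/seteqP; split=> // x _; exists (fun=> setT) => // a; exact: openT.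
Qed.

Lemma box_join (U V : forall a, set (X a)) (x : box_product X) :
  open_family U -> open_family V -> box U x -> box V x ->
  exists W, [/\ open_family W, box W x & box W `<=` box U `&` box V].
Proof.
move=> oU oV Ux Vx; exists (fun a => U a `&` V a); split.
- by move=> a; exact: openI.
- by move=> a; split.
- by move=> y Wy; split=> a; have [] := Wy a.
Qed.

HB.instance Definition _ := Choice.copy (box_product X) (forall a, X a).
HB.instance Definition _ :=
  isBaseTopological.Build (box_product X) box_cover box_join.

End box_topology.

Section pointed_box.
Context {A : Type} (X : A -> ptopologicalType).

Definition base_point : box_product X := fun a => point.

Definition support (x : box_product X) : set A := [set a | x a <> point].

Definition finite_support : set (box_product X) :=
  [set x | finite_set (support x)].

Definition support_le1 : set (box_product X) :=
  [set x | support x #<= `I_1].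

Lemma support_base_point : support base_point = set0.
Proof. by apply/seteqP; split=> // a; apply. Qed.

Lemma base_point_finite : base_point \in finite_support.
Proof. by rewrite inE /finite_support /= support_base_point. Qed.

Lemma base_point_le1 : base_point \in support_le1.
Proof. by rewrite inE /support_le1 /= support_base_point; exact: card_ge0. Qed.

Definition small_box_product : Type := set_type finite_support.
Definition box_bouquet : Type := set_type support_le1.

(* [set_type S] carries the topology induced by the inclusion of [S]. *)
HB.instance Definition _ := Topological.on small_box_product.
HB.instance Definition _ :=
  isPointed.Build small_box_product (exist _ base_point base_point_finite).

HB.instance Definition _ := Topological.on box_bouquet.
HB.instance Definition _ :=
  isPointed.Build box_bouquet (exist _ base_point base_point_le1).

End pointed_box.

(* Main.v *)
Require Import Defs.
From mathcomp Require Import all_boot all_classical topology.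

(** Every space in sight is a subspace of the box product formed by points of
    finite support, so it is enough to build one countable family of subsets of
    the box product that works for all sequences of such points
    ([strong_pytkeev_star_finite_support]).

    Let [e n : nat -> set (X n)] list a countable Pytkeev* network at the base
    point of [X n], and let [box U] be a basic neighborhood of the base point.
    Put [G n m] = the base point together with the union of those [e n i],
    [i < m], that contain the base point and lie in [U n], provided [n < m];
    otherwise [G n m] is the base point alone.  The boxes [box (G ^~ m)]
    increase with [m], lie in [box U], and each is coded by a finite list of
    finite lists of indices, so that all the boxes arising from all the [U] form
    a countable family ([coded_box]).

    It remains to see that a sequence [x] which accumulates at the base point
    meets one of these boxes infinitely often ([accumulating_box_exhaustion]).
    Suppose that it does not.  Let [A n] be the set of the indices [k] for which
    the coordinate [n] is the last one to enter: [x k n] in [G n m] already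
    forces [x k] in [box (G ^~ m)].  A point of finite support has such a
    coordinate, for only finitely many coordinates can delay it; so the sets
    [A n] cover all indices.  Along [A n] the sequence [x k n] meets each
    [G n m] finitely often, hence by the Pytkeev* property of [X n] it does not
    accumulate at the base point.  As [X n] is a T1 space, some neighborhood
    [V n] of the base point contains no other value [x k n] with [k] in [A n].
    Thus [x k] in [box V] implies that [x k n] is the base point for some [n]
    with [k] in [A n], hence [x k] is in [box (G ^~ 0)], which happens for
    finitely many [k] only: a contradiction.

    The sets [A n] are what makes the argument work for infinitely many factors:
    a decomposition of the indices by the support of [x k] would require, in
    each factor, the intersection of infinitely many neighborhoods. *)

Set Implicit Arguments.
Unset Strict Implicit.
Unset Printing Implicit Defensive.

Local Open Scope classical_set_scope.

Lemma countable_sub_range (T : pointedType) (A : set T) :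
  countable A -> exists e : nat -> T, A `<=` range e.
Proof.
move=> /countable_injP[f f_inj].
exists (fun i => xget point [set a | A a /\ f a = i]) => a Aa.
exists (f a) => //.
have [Ab fba] := @xgetPex _ point [set b | A b /\ f b = f a]
  (ex_intro _ a (conj Aa erefl)).
by apply: f_inj; [exact: mem_set|exact: mem_set|].
Qed.

Lemma infinite_nat_bij (A : set nat) :
  infinite_set A -> exists f : nat -> nat, set_bij setT A f.
Proof.
move=> infA; apply/card_set_bijP.
exact: card_esym (eq_card_nat (countableP A) infA).
Qed.

(** Enumerating [A] turns accumulation along a set of indices into accumulation
    of a genuine sequence, to which a Pytkeev* network applies. *)
Lemma accumulating_along (Z : topologicalType) (x : nat -> Z) (z : Z)
    (A : set nat) :
  (forall U, nbhs z U -> infinite_set [set k | A k /\ U (x k)]) ->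
  exists f : nat -> nat,
    [/\ injective f, (forall k, A (f k)) & accumulating (x \o f) z].
Proof.
move=> accA; have infA : infinite_set A.
  by apply: sub_infinite_set (accA setT filterT) => k [].
have [f [fA /in2TT f_inj fsurj]] := infinite_nat_bij infA.
exists f; split=> // [k|U /accA infU finU]; first exact: fA.
apply: infU; apply: sub_finite_set (finite_image f finU) => k [/fsurj[i _ <-]].
by exists i.
Qed.

(** In a T1 space, the finitely many values of [x] in [U] along [A] that differ
    from [z] can be removed from [U]. *)
Lemma nbhs_avoiding (Z : topologicalType) (x : nat -> Z) (z : Z)
    (A : set nat) (U : set Z) :
  accessible_space Z -> nbhs z U -> finite_set [set k | A k /\ U (x k)] ->
  exists V : set Z,
    [/\ open V, V z & forall k, A k -> V (x k) -> x k = z].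
Proof.
move=> /accessible_finite_set_closed fin_closed /nbhs_interior zU finU.
exists (U° `\` ((x @` [set k | A k /\ U (x k)]) `\ z)); split.
- rewrite setDE; apply: openI; first exact: open_interior.
  apply: closed_openC; apply: fin_closed.
  by apply: sub_finite_set (finite_image x finU); exact: subDsetl.
- by split=> [|[_ []] //]; exact: nbhs_singleton.
- move=> k Ak [/interior_subset Uxk notx]; apply: contrapT => xkz.
  by apply: notx; split=> //; exists k.
Qed.

(** Finiteness of the support provides a least [m] with [x] in [box (G ^~ m)].  If
    [m] is 0, every coordinate will do; otherwise one that lies outside its
    [m.-1]-th set enters last. *)
Lemma last_coordinate (X : nat -> ptopologicalType)
    (G : forall n, nat -> set (X n)) (x : box_product X) :
  (forall n, {homo G n : i j / (i <= j)%N >-> i `<=` j}) ->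
  (forall n m, G n m point) ->
  Defs.finite_support x -> (forall n, exists m, G n m (x n)) ->
  exists n, forall m, G n m (x n) -> box (G ^~ m) x.
Proof.
move=> G_homo G_point /finite_seqP[s supp_s] /choice[h Gh].
have entered : exists m, (fun m => `[< box (G ^~ m) x >]) m.
  exists (\max_(n <- s) h n); apply/asboolP => n.
  have [->//|xn] := pselect (x n = point).
  apply: G_homo (Gh n); apply: leq_bigmax_seq => //.
  by have : Defs.support x n by []; rewrite supp_s.
case: (ex_minnP entered) => -[|m'] /asboolP Gm' m'_min.
  by exists 0 => j _ n; apply: G_homo (Gm' n).
have /existsNP[n Gn] : ~ box (G ^~ m') x.
  by move=> /asboolP/m'_min; rewrite ltnn.
exists n => j Gnj i; apply: (G_homo) (Gm' i); rewrite ltnNge.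
by apply/negP => jm'; apply: Gn; apply: G_homo Gnj.
Qed.

Lemma box_open_nbhs (A : Type) (X : A -> topologicalType)
    (U : forall a, set (X a)) (x : box_product X) :
  (forall a, open (U a)) -> box U x -> open_nbhs x (box U).
Proof.
move=> oU Ux; split=> //; exists [set U]; last by rewrite bigcup_set1.
by move=> _ ->.
Qed.

Lemma nbhs_boxP (A : Type) (X : A -> topologicalType)
    (x : box_product X) (O : set (box_product X)) :
  nbhs x O -> exists U : forall a, set (X a),
    [/\ (forall a, open (U a)), box U x & box U `<=` O].
Proof.
rewrite nbhsE => -[_ [[F oF <-] [U FU Ux]] FO].
by exists U; split=> //; [exact: oF|move=> y Uy; apply: FO; exists U].
Qed.

(** The core of the proof, with the networks abstracted to increasing sets [G n m]
    that every sequence accumulating at the base point meets infinitely often for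
    some [m].  Testing [x] on basic neighborhoods only makes the result apply to
    sequences of any subspace of the box product. *)
Lemma accumulating_box_exhaustion (X : nat -> ptopologicalType)
    (G : forall n, nat -> set (X n)) (x : nat -> box_product X) :
  (forall n, accessible_space (X n)) ->
  (forall n, {homo G n : i j / (i <= j)%N >-> i `<=` j}) ->
  (forall n m, G n m point) ->
  (forall n (y : nat -> X n), accumulating y point ->
    exists m, infinite_set [set k | G n m (y k)]) ->
  (forall k, Defs.finite_support (x k)) ->
  (forall V : forall n, set (X n), (forall n, open (V n)) ->
    (forall n, V n point) -> infinite_set [set k | box V (x k)]) ->
  exists m, infinite_set [set k | box (G ^~ m) (x k)].
Proof.
move=> T1 G_homo G_point G_meets fin_x acc_x; apply: contrapT => /forallNP.
move=> /(_ _)/contrapT fin_G.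
pose A n := [set k | forall m, G n m (x k n) -> box (G ^~ m) (x k)].
have A_fin n m : finite_set [set k | A n k /\ G n m (x k n)].
  by apply: sub_finite_set (fin_G m) => k [Ak /Ak].
have A_cover k : exists n, A n k.
  have [Gk|/existsNP[n Gn]] := pselect (forall n, exists m, G n m (x k n)).
    exact: last_coordinate.
  (* A coordinate that never enters also belongs here, vacuously. *)
  by exists n => m Gm; case: Gn; exists m.
have V_ex n : exists V : set (X n),
    [/\ open V, V point & forall k, A n k -> V (x k n) -> x k n = point].
  have [U [nU finU]] : exists U : set (X n),
      nbhs (point : X n) U /\ finite_set [set k | A n k /\ U (x k n)].
    apply: contrapT => noU.
    have [|f [f_inj Af accf]] := @accumulating_along _ (x ^~ n) point (A n).
      by move=> U nU finU; apply: noU; exists U.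
    have [m infm] := G_meets n _ accf.
    apply: infm; apply: card_le_finite (A_fin n m).
    have := @card_ge_preimage _ _ [set k | A n k /\ G n m (x k n)] f.
    move=> /(_ (in2W f_inj)); apply: card_le_trans.
    by apply: subset_card_le => k Gk; split.
  exact: nbhs_avoiding (T1 n) nU finU.
pose V n := sval (cid (V_ex n)).
have VP n := svalP (cid (V_ex n)).
have V_open n : open (V n) by case: (VP n).
have V_point n : V n point by case: (VP n).
apply: (acc_x V V_open V_point); apply: sub_finite_set (fin_G 0) => k Vk.
have [n Ank] := A_cover k; apply: (Ank).
have [_ _ Vpoint] := VP n.
by rewrite (Vpoint k Ank (Vk n)).
Qed.

(** Countability of the family is the reason for coding by lists of numbers.
    The list [s] codes finite unions of listed sets in finitely many coordinates;
    the default value [[::]] of [nth] leaves only the base point in the others. *)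
Definition coded_box (X : nat -> ptopologicalType)
    (e : forall n, nat -> set (X n)) (s : seq (seq nat)) :
    set (box_product X) :=
  [set x | forall n, x n = point \/
                     exists2 i, i \in nth [::] s n & e n i (x n)].

(** A single family of coded boxes, traced on [S], serves the box-bouquet and the
    small box-product alike, since both carry the topology induced from the box
    product and consist of points of finite support. *)
Lemma strong_pytkeev_star_finite_support (X : nat -> ptopologicalType)
    (S : set (box_product X)) (p : S) :
  (forall n, accessible_space (X n)) ->
  (forall n, strong_pytkeev_star (X n) point) ->
  S `<=` @Defs.finite_support _ X -> \val p = base_point X ->
  strong_pytkeev_star S p.
Proof.
move=> T1 X_pytkeev S_fin p_base.
have e_ex n : exists e : nat -> set (X n),
    forall (O : set (X n)) (y : nat -> X n), nbhs (point : X n) O ->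
      accumulating y point -> exists i,
        [/\ e i point, e i `<=` O & infinite_set [set k | e i (y k)]].
  have [NN /countable_sub_range[e NNe] NN_net] := X_pytkeev n.
  exists e => O y nO /NN_net-/(_ _ nO)[N [/NNe[i _ <-] ? ? ?]].
  by exists i.
pose e n := sval (cid (e_ex n)).
have eP n := svalP (cid (e_ex n)).
exists (range (fun s => [set y : S | coded_box e s (\val y)])).
  exact: card_le_trans (card_image_le _ _) (countableP _).
move=> O x [_ [[W oW <-] Wp] WO] acc_x.
have [U [U_open Up UW]] := nbhs_boxP (open_nbhs_nbhs (conj oW Wp)).
have U_point n : U n point by have := Up n; rewrite set_valE p_base.
pose good n i := `[< e n i point /\ e n i `<=` U n >].
(* Requiring [n < m] keeps each [box (G ^~ m)] finitely coded; requiring [i < m]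
   makes it a finite union in each coordinate. *)
pose G n m := [set y : X n | y = point \/
  exists2 i, (n < m)%N && (i < m)%N && good n i & e n i y].
have [] := @accumulating_box_exhaustion X G (fun k => \val (x k)) T1.
- move=> n i j ij y [->|[h /andP[/andP[ni hi] gh] ehy]]; first by left.
  by right; exists h => //; rewrite (leq_trans ni ij) (leq_trans hi ij).
- by move=> n m; left.
- move=> n y acc_y.
  have nU : nbhs (point : X n) (U n) by apply: open_nbhs_nbhs; split.
  have [i [ei eiU inf_i]] := eP n _ _ nU acc_y.
  exists (maxn n i).+1; apply: sub_infinite_set inf_i => k eiy.
  right; exists i => //.
  by rewrite !ltnS leq_maxl leq_maxr; apply/asboolP.
- by move=> k; apply: S_fin; exact: set_valP.
- move=> V V_open V_point.
  apply: (acc_x [set y : S | box V (\val y)]).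
  exists [set y : S | box V (\val y)]; split=> //.
    exists (box V) => //.
    by have [] := box_open_nbhs (x := base_point X) V_open V_point.
  by rewrite /= p_base.
move=> m inf_m.
pose s := mkseq (fun n => [seq i <- iota 0 m | good n i]) m.
have Gs : box (G ^~ m) = coded_box e s.
  apply/seteqP; split=> y Gy n; case: (Gy n) => [|[i]]; try by left.
    move=> /andP[/andP[nm im] gi] ei; right; exists i => //.
    by rewrite nth_mkseq// mem_filter gi mem_iota.
  have [nm|mn] := ltnP n m; last by rewrite nth_default ?size_mkseq.
  rewrite nth_mkseq// mem_filter mem_iota => /andP[gi im] ei.
  by right; exists i => //; rewrite nm gi andbT.
have GU : box (G ^~ m) `<=` box U.
  move=> y Gy n; case: (Gy n) => [->|[i /andP[_ /asboolP[_ eU]] /eU//]].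
  exact: U_point.
exists [set y : S | coded_box e s (\val y)]; split.
- by exists s.
- by rewrite /= p_base => n; left.
- by move=> y; rewrite /= -Gs => /GU/UW/WO.
- by rewrite /= -Gs.
Qed.

Theorem proposition6p6 (X : nat -> ptopologicalType)
  (X_T1 : forall n, accessible_space (X n))
  (X_pytkeev : forall n, strong_pytkeev_star (X n) point) :
  strong_pytkeev_star (box_bouquet X) point /\
  strong_pytkeev_star (small_box_product X) point.
Proof.
split; apply: strong_pytkeev_star_finite_support => // x.
by move=> /card_le_finite; apply; exact: finite_II.
Qed.
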